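(* Let $R$ be a ring with unity $1\neq 0$ which is not a field, and let $M$ be an $R$-module. If $M$ is semisimple, then $M$ does not contain any proper essential submodule. Hence, for any field $\mathbb{k}$, any $\mathbb{k}$-vector space $V$ does not contain any proper essential subspace.
   Context: A proper essential submodule of a module $M$ is a submodule $E$ of $M$ with $E\neq\{0_M\}$, $E\neq M$, such that $E\cap N\neq\{0_M\}$ for every nonzero submodule $N$ of $M$. A proper essential subspace of a vector space is a proper essential submodule of it as a $\mathbb{k}$-module. A module is semisimple if it is a direct sum of simple submodules. *)

(* Defs.v *)
From HB Require Import structures.
From mathcomp Require Import all_boot all_order all_algebra.
From mathcomp Require Import all_classical.

Set Implicit Arguments.
Unset Strict Implicit.
Unset Printing Implicit Defensive.

Import GRing.Theory.
Local Open Scope classical_set_scope.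
Local Open Scope ring_scope.

(* [nzRingType] is neither commutative nor equipped with inverses, so being a
   field is a property of the bare ring; [1 != 0] is part of [nzRingType]. *)
Definition is_field (R : nzRingType) : Prop :=
  commutative (@GRing.mul R) /\
  (forall x : R, x != 0 -> exists y : R, y * x = 1).

Definition submodule (R : nzRingType) (M : lmodType R) (N : set M) : Prop :=
  submod_closed (mem N).

Definition proper_essential (R : nzRingType) (M : lmodType R) (E : set M) :
    Prop :=
  [/\ submodule E, E <> [set 0], E <> [set: M] &
      forall N : set M, submodule N -> N <> [set 0] -> E `&` N <> [set 0]].

Definition simple_submodule (R : nzRingType) (M : lmodType R) (S : set M) :
    Prop :=
  [/\ submodule S, S <> [set 0] &
      forall N : set M, submodule N -> N `<=` S -> N = [set 0] \/ N = S].

(* [M] is the internal direct sum of the [S i]: each element is in exactly one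
   way a sum of a finitely supported family of elements of the [S i]. The
   explicit finiteness is needed since the library's [\sum_(i \in _)] is [0] on
   families of infinite support. *)
Definition is_direct_sum (R : nzRingType) (M : lmodType R) (I : choiceType)
    (S : I -> set M) : Prop :=
  forall x : M, exists! f : I -> M,
    [/\ forall i, S i (f i),
        finite_set [set i | f i != 0] &
        x = \sum_(i \in [set: I]) f i].

Definition semisimple (R : nzRingType) (M : lmodType R) : Prop :=
  exists (I : choiceType) (S : I -> set M),
    (forall i, simple_submodule (S i)) /\ is_direct_sum S.

(* Main.v *)
Require Import Defs.
From HB Require Import structures.
From mathcomp Require Import all_boot all_order all_algebra.
From mathcomp Require Import all_classical.

Set Implicit Arguments.
Unset Strict Implicit.
Unset Printing Implicit Defensive.

Import GRing.Theory.
Local Open Scope classical_set_scope.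
Local Open Scope ring_scope.

(** An essential submodule contains every simple submodule ([simple_sub_essential]), so when the
    simple submodules span [M] it is all of [M], against properness. Over a field, the same idea is
    applied directly to the lines spanned by nonzero vectors, with no decomposition or basis of [V]
    chosen. *)

Section Submodules.
Variables (R : nzRingType) (M : lmodType R).
Implicit Types (E N : set M) (x u v : M).

Lemma submoduleP N :
  submodule N <-> N 0 /\ (forall (a : R) u v, N u -> N v -> N (a *: u + v)).
Proof.
split=> [[N0 NL]|[N0 NL]].
  split=> [|a u v Nu Nv]; first exact: set_mem N0.
  by apply: set_mem; apply: NL; apply: mem_set.
split=> [|a u v /set_mem Nu /set_mem Nv]; apply: mem_set => //.
exact: NL.
Qed.

Lemma submoduleI E N : submodule E -> submodule N -> submodule (E `&` N).
Proof.
move=> /submoduleP[E0 EL] /submoduleP[N0 NL]; apply/submoduleP; split=> //.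
by move=> a u v [Eu Nu] [Ev Nv]; split; [exact: EL | exact: NL].
Qed.

Lemma submodule_cyclic x : submodule [set a *: x | a in [set: R]].
Proof.
apply/submoduleP; split; first by exists 0; rewrite ?scale0r.
move=> a _ _ [b _ <-] [c _ <-]; exists (a * b + c) => //.
by rewrite scalerDl scalerA.
Qed.

(** The sum is an iterated addition over a finite list, which is empty when the support is infinite,
    so closure under [0] and [+] suffices. *)
Lemma submodule_fsum (I : choiceType) N (f : I -> M) :
  submodule N -> (forall i, N (f i)) -> N (\sum_(i \in [set: I]) f i).
Proof.
move=> /submoduleP[N0 NL] Nf.
apply: (big_ind N) => // u v Nu Nv.
by rewrite -[u]scale1r; exact: NL.
Qed.

(** Since [E] is essential, its intersection with [S] is a nonzero submodule of [S]; by simplicity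
    it equals [S]. *)
Lemma simple_sub_essential E S :
  proper_essential E -> simple_submodule S -> S `<=` E.
Proof.
move=> [Esub _ _ Eess] [Ssub S_neq0 Smin].
have [/(Eess _ Ssub S_neq0)//|<-] :=
  Smin _ (submoduleI Esub Ssub) (@subIsetr _ E S).
exact: subIsetl.
Qed.

Lemma semisimple_no_proper_essential E : semisimple M -> ~ proper_essential E.
Proof.
move=> [I [S [Ssimple Ssum]]] Eess.
have [Esub _ E_neqT _] := Eess.
apply/E_neqT/seteqP; split=> // x _.
have [f [[Sf _ ->] _]] := Ssum x.
by apply: submodule_fsum => // i; exact: simple_sub_essential (Sf i).
Qed.

End Submodules.

(* A nonzero [a *: x] in [E] can be rescaled to [x], so an essential subspace
   contains every line. *)
Lemma vector_space_no_proper_essential (k : fieldType) (V : lmodType k)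
  (E : set V) : ~ proper_essential E.
Proof.
move=> [/submoduleP[E0 EL] _ E_neqT Eess].
apply/E_neqT/seteqP; split=> // x _.
have [->//|x_neq0] := eqVneq x 0.
have line_neq0 : [set a *: x | a in [set: k]] <> [set 0].
  move=> line0; have : [set a *: x | a in [set: k]] x.
    by exists 1; rewrite ?scale1r.
  by rewrite line0 => /eqP; rewrite (negPf x_neq0).
(* If [x] were outside [E], then [E] would meet the line of [x] only in [0], contradicting
   essentiality. *)
apply: contrapT => nEx; apply: (Eess _ (submodule_cyclic x) line_neq0).
apply/seteqP; split=> [y [Ey [a _ axy]]|_ ->]; last first.
  by split=> //; exists 0; rewrite ?scale0r.
rewrite -{y}axy in Ey *.
have [->|a_neq0] := eqVneq a 0; first by rewrite /= scale0r.
(* Writes [x] as [a^-1 *: (a *: x) + 0], the shape that [EL] expects. *)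
case: nEx; rewrite -[x]addr0 -[x](scalerK a_neq0).
exact: EL.
Qed.

Theorem proposition1p2 :
  (forall (R : nzRingType) (M : lmodType R),
     ~ is_field R -> semisimple M ->
     ~ (exists E : set M, proper_essential E)) /\
  (forall (k : fieldType) (V : lmodType k),
     ~ (exists E : set V, proper_essential E)).
Proof.
split=> [R M _ Mss [E]|k V [E]].
  exact: semisimple_no_proper_essential.
exact: vector_space_no_proper_essential.
Qed.
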